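(* Let $r\in(0,1]$. For every $1\le\ell\le\infty$, the correlation integral $\mathrm{c}_\ell^{f_\alpha}(r)$ and the asymptotic determinism $\mathrm{det}_\ell^{f_\alpha}(r)$ are continuous functions of $\alpha\in(0,1/2)$.
   Context: For $\alpha\in(0,1/2)$ the continuous map $f_\alpha:[0,1]\to[0,1]$ is defined by: $f_\alpha(x)=x-1+2\alpha^{j-1}-\alpha^j$ for $x\in[1-\alpha^{j-1},1-\alpha^{j-1}+\alpha^j]$, $j\ge1$; $f_\alpha(x)=\frac{1-\alpha+\alpha^2}{2\alpha-1}(x-1)+\alpha^{j+1}\frac{2-\alpha}{2\alpha-1}$ for $x\in(1-\alpha^{j-1}+\alpha^j,1-\alpha^j)$, $j\ge1$; and $f_\alpha(1)=0$. For a word $u=u_1\dots u_k\in\{0,1\}^k$ put $\kappa(u)=(1-\alpha)\sum_{i=1}^k u_i\alpha^{i-1}$ and $I_\alpha(u)=[\kappa(u),\kappa(u)+\alpha^k]$. The measure $\mu_\alpha$ is the unique Borel probability measure on $[0,1]$ with $\mu_\alpha(I_\alpha(u))=2^{-k}$ for all $k\ge1$ and $u\in\{0,1\}^k$. For $1\le\ell\le\infty$, $r>0$: $\varrho_\ell(x,y)=\sup\{|f_\alpha^i(x)-f_\alpha^i(y)| : 0\le i<\ell\}$, $\mathrm{c}_\ell^{f_\alpha}(r)=\mu_\alpha\times\mu_\alpha\{(x,y):\varrho_\ell(x,y)\le r\}$, $\mathrm{det}_\ell^{f_\alpha}(r)=\frac{\ell\,\mathrm{c}_\ell^{f_\alpha}(r)-(\ell-1)\mathrm{c}_{\ell+1}^{f_\alpha}(r)}{\mathrm{c}_1^{f_\alpha}(r)}$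 for $\ell<\infty$, and $\mathrm{det}_\infty^{f_\alpha}(r)=\mathrm{c}_\infty^{f_\alpha}(r)/\mathrm{c}_1^{f_\alpha}(r)$. *)

(* Defs.v *)
From HB Require Import structures.
From mathcomp Require Import all_boot all_order all_algebra.
From mathcomp Require Import all_classical all_reals all_analysis.
Set Implicit Arguments.
Unset Strict Implicit.
Unset Printing Implicit Defensive.
Import Order.TTheory GRing.Theory Num.Theory.
Import numFieldNormedType.Exports.
Local Open Scope classical_set_scope.
Local Open Scope ring_scope.

(* Throughout, the parameter [a] is meant to range over ]0, 1/2[. *)

(* Clauses of the piecewise definition of the interval map: [falpha_spec a x y]
   says that one of the clauses applies to [x] and prescribes the value [y]. *)
Definition falpha_spec (R : realType) (a x y : R) : Prop :=
  [\/ exists j : nat, [/\ (1 <= j)%N,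
        x \in `[1 - a ^+ j.-1, 1 - a ^+ j.-1 + a ^+ j]
        & y = x - 1 + 2 * a ^+ j.-1 - a ^+ j],
      exists j : nat, [/\ (1 <= j)%N,
        x \in `]1 - a ^+ j.-1 + a ^+ j, 1 - a ^+ j[
        & y = (1 - a + a ^+ 2) / (2 * a - 1) * (x - 1)
              + a ^+ j.+1 * ((2 - a) / (2 * a - 1))]
    | x = 1 /\ y = 0].

(* For 0 < a < 1/2 exactly one clause applies to each x in [0, 1] and none
   applies outside, where falpha takes the junk value 0. *)
Definition falpha (R : realType) (a x : R) : R :=
  xget 0 [set y | falpha_spec a x y].

Definition kappa (R : realType) (a : R) (k : nat) (u : k.-tuple bool) : R :=
  (1 - a) * \sum_(i < k) (tnth u i)%:R * a ^+ i.

Definition Ialpha (R : realType) (a : R) (k : nat) (u : k.-tuple bool) : set R :=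
  `[kappa a u, kappa a u + a ^+ k]%classic.

(* Borel probability measures on [0, 1] are represented as the Borel
   probability measures on the line giving mass 1 to [0, 1]. *)
Definition is_mu_alpha (R : realType) (a : R)
    (m : probability (measurableTypeR R) R) : Prop :=
  m `[0, 1]%classic = 1%E /\
  forall (k : nat) (u : k.-tuple bool), (1 <= k)%N ->
    m (Ialpha a u) = ((2 ^- k)%:E)%E.

(* For 0 < a < 1/2 there is exactly one measure as above. *)
Definition mu_alpha (R : realType) (a : R)
    : probability (measurableTypeR R) R :=
  get (is_mu_alpha a : set (pprobability (measurableTypeR R) R)).

(* The length l in {1, 2, ...} \cup {oo} is encoded in [option nat], with
   [None] standing for oo (and [Some 0] excluded from statements). *)
Definition below (l : option nat) (i : nat) : Prop :=
  if l is Some n then (i < n)%N else True.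

Definition rho (R : realType) (a : R) (l : option nat) (x y : R) : R :=
  sup [set `|iter i (falpha a) x - iter i (falpha a) y| | i in below l].

Definition corr_int (R : realType) (l : option nat) (r a : R) : R :=
  fine ((mu_alpha a \x mu_alpha a)%E
    [set z : measurableTypeR R * measurableTypeR R |
      [/\ z.1 \in `[0, 1], z.2 \in `[0, 1] & rho a l z.1 z.2 <= r]]).

Definition asym_det (R : realType) (l : option nat) (r a : R) : R :=
  if l is Some n then
    (n%:R * corr_int (Some n) r a - (n%:R - 1) * corr_int (Some n.+1) r a)
      / corr_int (Some 1%N) r a
  else corr_int None r a / corr_int (Some 1%N) r a.

(* Main.v *)
From HB Require Import structures.
Require Import Defs.
From mathcomp Require Import all_boot all_order all_algebra.
From mathcomp Require Import all_classical all_reals all_analysis.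
From mathcomp Require Import measurable_realfun zify ring lra.
Import Order.TTheory GRing.Theory Num.Theory.
Import numFieldNormedType.Exports.
Local Open Scope classical_set_scope.
Local Open Scope ring_scope.

(* The map falpha sends the basic interval of a word of length k into the basic
   interval of its successor under the k-digit odometer, that is addition of 1 on
   Z/2^k when words are read as binary numbers, least significant digit first.
   Hence, up to an error a^k, rho between points of two basic intervals is the
   supremum of |kap (n + i) - kap (m + i)| over the admissible times i, where
   kap : Z/2^k -> R gives the left endpoints. Thus corr_int at r is squeezed
   between the proportions of pairs (n, m) for which this supremum is at most
   r - a^k, respectively r + a^k. For fixed k the left endpoints depend
   continuously on a, so that the oscillation of corr_int at a is at most the
   proportion of pairs whose supremum is within 2 a^k of r. Distinct left endpoints
   are more than a^k apart, so each condition |kap (n + c) - d| <= 2 a^k leaves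
   at most 5 values of n, and for l finite the proportion is O(l / 2^k). For l
   infinite, kap is subadditive on Z/2^k, so that the supremum over the whole orbit
   is max (kap (n - m)) (kap (m - n)), and the same count applies. *)

(** * Left endpoints of the basic intervals *)

(* The number [kappa] of the word formed by the [k] lowest binary digits of [n],
   least significant digit first. *)
Fixpoint kap {R : realType} (a : R) (k n : nat) : R :=
  if k is k'.+1 then (1 - a) * (odd n)%:R + a * kap a k' n./2 else 0.

Lemma kap_itv {R : realType} (a : R) (k n : nat) :
  0 < a < 1 -> 0 <= kap a k n <= 1 - a ^+ k.
Proof.
move=> /andP[a0 a1]; elim: k n => [|k IH] n /=; first by rewrite expr0 subrr lexx.
have /andP[h0 h1] := IH n./2; rewrite exprS.
have := ler_wpM2l (ltW a0) h1; have := mulr_ge0 (ltW a0) h0.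
by case: (odd n) => /= *; lra.
Qed.

Lemma kap0 {R : realType} (a : R) (k : nat) : kap a k 0 = 0.
Proof. by elim: k => //= k ->; rewrite !mulr0 addr0. Qed.

Lemma half_addn_expS (n m k : nat) : (n + 2 ^ k.+1 * m)./2 = (n./2 + 2 ^ k * m)%N.
Proof. by rewrite expnS; lia. Qed.

Lemma kapDexp {R : realType} (a : R) (k n m : nat) :
  kap a k (n + 2 ^ k * m) = kap a k n.
Proof.
elim: k n => //= k IH n.
by rewrite half_addn_expS IH oddD oddM oddX /= addbF.
Qed.

(** Equal leading digits cancel and leave a common factor [a]. Different leading digits put the
    endpoints at least [(1 - a) - a * (1 - a ^+ k)] apart, which exceeds [a ^+ k.+1] because
    [a < 1 / 2]. *)
Lemma kap_gap {R : realType} (a : R) (k n m : nat) : 0 < a < 1 / 2 ->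
  `|kap a k n - kap a k m| <= a ^+ k -> n = m %[mod 2 ^ k].
Proof.
move=> /andP[a0 a12]; have a01 : 0 < a < 1 by lra.
elim: k n m => [|k IH] n m /=; first by rewrite !modn1.
have /andP[n0 n1] := kap_itv a k n./2 a01; have /andP[m0 m1] := kap_itv a k m./2 a01.
have [nm|nm] := eqVneq (odd n) (odd m).
  rewrite nm opprD addrACA subrr add0r -mulrBr normrM gtr0_norm// exprS ler_pM2l//.
  move=> /IH h; rewrite -(odd_double_half n) -(odd_double_half m) nm expnS -!mul2n.
  by apply/eqP; rewrite eqn_modDl -!muln_modr h.
have ak0 : 0 < a * a ^+ k by rewrite -exprS exprn_gt0.
move: (ler_wpM2l (ltW a0) n0) (ler_wpM2l (ltW a0) n1).
move: (ler_wpM2l (ltW a0) m0) (ler_wpM2l (ltW a0) m1).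
rewrite ler_norml exprS.
by case: (odd n) (odd m) nm => -[]//= _ ? ? ? ? /andP[h1 h2]; exfalso; lra.
Qed.

(** Induction on the digits. Without a carry the leading digits add exactly and the tails use the
    induction hypothesis; with a carry the left side is below [a], while the two leading digits on
    the right already give [2 * (1 - a) > 1]. *)
Lemma kapD {R : realType} (a : R) (k n m : nat) : 0 < a < 1 / 2 ->
  kap a k (n + m) <= kap a k n + kap a k m.
Proof.
move=> /andP[a0 a12]; have a01 : 0 < a < 1 by lra.
elim: k n m => [|k IH] n m /=; first by rewrite addr0.
rewrite oddD halfD.
have /andP[n0 _] := kap_itv a k n./2 a01; have /andP[m0 _] := kap_itv a k m./2 a01.
move: (ler_wpM2l (ltW a0) n0) (ler_wpM2l (ltW a0) m0).
case: (odd n); case: (odd m) => /=; rewrite ?add0n ?add1n.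
- have /andP[_ h1] := kap_itv a k (n./2 + m./2).+1 a01.
  have := ler_wpM2l (ltW a0) h1; have := exprn_gt0 k.+1 a0; rewrite exprS; lra.
- by have := ler_wpM2l (ltW a0) (IH n./2 m./2); lra.
- by have := ler_wpM2l (ltW a0) (IH n./2 m./2); lra.
- by have := ler_wpM2l (ltW a0) (IH n./2 m./2); lra.
Qed.

Lemma kap_lipschitz {R : realType} (a b : R) (k n : nat) : 0 < a < 1 -> 0 < b < 1 ->
  `|kap b k n - kap a k n| <= k%:R * `|b - a|.
Proof.
move=> a01 /andP[b0 b1]; elim: k n => [|k IH] n /=.
  by rewrite subrr normr0 mul0r.
have /andP[n0 n1] := kap_itv a k n./2 a01.
have {}n1 : kap a k n./2 <= 1.
  by case/andP: a01 => a0 _; have := exprn_gt0 k a0; lra.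
set o := (odd n)%:R; set x := kap b k _; set y := kap a k _.
(* The first term costs at most [|b - a|], since [|y - o| <= 1]; the second contracts the error of
   the tail by [b]. *)
have -> : (1 - b) * o + b * x - ((1 - a) * o + a * y) =
          (b - a) * (y - o) + b * (x - y) by ring.
have o01 : 0 <= o <= 1 by rewrite /o; case: odd; rewrite ?lexx ?ler01.
rewrite -/y in n0 n1; have {}IH := IH n./2; rewrite -/x -/y in IH; clearbody x y o.
apply: (le_trans (ler_normD _ _)); rewrite !normrM (gtr0_norm b0).
have h1 : `|b - a| * `|y - o| <= `|b - a| * 1.
  by apply: ler_wpM2l => //; rewrite ler_norml; lra.
have h2 : b * `|x - y| <= `|x - y| by rewrite ler_piMl// ltW.
by rewrite -(natr1 k); lra.
Qed.

Lemma expr_lipschitz {R : realType} (a b : R) (k : nat) : 0 < a < 1 -> 0 < b < 1 ->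
  `|b ^+ k - a ^+ k| <= k%:R * `|b - a|.
Proof.
move=> /andP[a0 a1] /andP[b0 b1]; elim: k => [|k IH].
  by rewrite !expr0 subrr normr0 mul0r.
have -> : b ^+ k.+1 - a ^+ k.+1 = b * (b ^+ k - a ^+ k) + (b - a) * a ^+ k.
  by rewrite !exprS; ring.
apply: (le_trans (ler_normD _ _)); rewrite !normrM (gtr0_norm b0).
rewrite [`|a ^+ k|](ger0_norm (exprn_ge0 k (ltW a0))).
have h1 : `|b - a| * a ^+ k <= `|b - a| * 1.
  by apply: ler_wpM2l => //; rewrite exprn_ile1// ltW.
have h2 : b * `|b ^+ k - a ^+ k| <= `|b ^+ k - a ^+ k| by rewrite ler_piMl// ltW.
by rewrite -(natr1 k); lra.
Qed.

Lemma kappaE {R : realType} (a : R) (k n : nat) :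
  kap a k n = kappa a [tuple odd (n %/ 2 ^ i) | i < k].
Proof.
rewrite /kappa; elim: k n => [|k IH] n /=; first by rewrite big_ord0 mulr0.
rewrite big_ord_recl /= IH tnth_mktuple expn0 divn1 expr0 mulr1 mulrDr; congr (_ + _).
rewrite mulrCA; congr (_ * _); rewrite mulr_sumr; apply: eq_bigr => i _.
by rewrite !tnth_mktuple /= /bump /= add1n -divn2 -divnMA -expnS exprS mulrCA.
Qed.

(** After division by [a ^+ k] the admissible values lie in an interval of length 4, covered by five
    half-open unit cells; by [kap_gap] no two indices share a cell. The map [g] allows for shifts
    and reflections of the index. *)
Lemma card_kap_near {R : realType} (a c : R) (k : nat) (g : 'I_(2 ^ k) -> nat) :
  0 < a < 1 / 2 -> (forall i j, g i = g j %[mod 2 ^ k] -> i = j) ->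
  (#|[set i | (`|kap a k (g i) - c| <= 2 * a ^+ k)%R]%SET| <= 5)%N.
Proof.
move=> a012 gI; set S := [set i | _]%SET.
have ak0 : 0 < a ^+ k by case/andP: a012 => a0 _; rewrite exprn_gt0.
pose h i := (kap a k (g i) - c) / a ^+ k + 2.
have h05 i : i \in S -> 0 <= h i < 5.
  rewrite inE ler_norml => /andP[h1 h2]; rewrite /h -ltrBrDr -lerBlDr.
  by rewrite ler_pdivlMr// ltr_pdivrMr//; lra.
pose q i : 'I_5 := inord (Num.truncn (h i)).
have qI : {in S &, injective q}.
  move=> i j iS jS /(congr1 val) /=.
  have tr i' : i' \in S -> (Num.truncn (h i') < 5)%N.
    by move=> /h05/andP[h0 h5]; rewrite truncn_lt_nat.
  rewrite !inordK ?tr// => e; apply: gI; apply: (@kap_gap R a) => //.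
  have /andP[hi _] := h05 _ iS; have /andP[hj _] := h05 _ jS.
  have := truncn_itv hi; have := truncn_itv hj; rewrite e -(natr1 (Num.truncn _)).
  move=> /andP[e1 e2] /andP[e3 e4].
  have -> : kap a k (g i) - kap a k (g j) = (h i - h j) * a ^+ k.
    by rewrite /h; field; rewrite gt_eqF.
  rewrite normrM (gtr0_norm ak0) -[leRHS]mul1r ler_pM2r// ler_norml.
  by lra.
by rewrite -(card_in_imset qI) (leq_trans (max_card _))// card_ord.
Qed.

(** Union bound on each fibre of the second coordinate, which is covered by [#|I|] sets of at most
    [C] elements. *)
Lemma card_pairs_le (N C : nat) (I : finType) (A : I -> 'I_N -> {set 'I_N})
    (S : {set 'I_N * 'I_N}) :
  (forall j m, #|A j m| <= C)%N ->
  (forall p, p \in S -> exists j, p.1 \in A j p.2) ->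
  (#|S| <= N * (#|I| * C))%N.
Proof.
move=> AC SA.
have -> : #|S| = (\sum_(m < N) #|[set n | (n, m) \in S]%SET|)%N.
  rewrite -sum1_card (partition_big snd predT)//=.
  apply: eq_bigr => m _; rewrite -sum1_card (reindex (fun n => (n, m)))/=.
    by apply: eq_bigl => n; rewrite inE /= eqxx andbT.
  by exists fst => [n//|[n m'] /andP[_ /eqP/= ->]].
rewrite -[X in (_ <= X * _)%N]card_ord -sum_nat_const; apply: leq_sum => m _.
apply: (@leq_trans #|(\bigcup_(j in I) A j m)%SET|).
  apply: subset_leq_card; apply/fintype.subsetP => n; rewrite inE => /SA[j nA].
  by apply/finset.bigcupP; exists j.
rewrite -sum_nat_const; apply: (@leq_trans (\sum_(j in I) #|A j m|)%N);
  last by apply: leq_sum => j _; exact: AC.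
by elim/big_rec2: _ => [|j x y _ h]; rewrite ?cards0// (leq_trans (leq_card_setU _ _))// leq_add2l.
Qed.

(** * The interval map acts as an odometer *)

(** The affine clauses of [falpha_spec] with the index lowered by one, so that [j] ranges over all
    natural numbers. *)
Definition falpha_left {R : realType} (a : R) (j : nat) (x : R) : R :=
  x - 1 + 2 * a ^+ j - a ^+ j.+1.

Definition falpha_right {R : realType} (a : R) (j : nat) (x : R) : R :=
  (1 - a + a ^+ 2) / (2 * a - 1) * (x - 1) + a ^+ j.+2 * ((2 - a) / (2 * a - 1)).

Lemma exists_expr_gap {R : realType} (a x : R) : 0 < a < 1 -> 0 <= x < 1 ->
  exists j, 1 - a ^+ j <= x < 1 - a ^+ j.+1.
Proof.
move=> /andP[a0 a1] /andP[x0 x1].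
have ex : exists n, a ^+ n < 1 - x.
  have h : \forall n \near \oo, `|0 - a ^+ n| < 1 - x.
    apply: cvgr_dist_lt; last by rewrite subr_gt0.
    by apply: cvg_expr; rewrite gtr0_norm.
  case: h => N _ /(_ N (leqnn N)) /=; rewrite sub0r normrN gtr0_norm ?exprn_gt0//.
  by exists N.
(* The gap index is the predecessor of the least exponent [n] with [a ^+ n < 1 - x], which is not 0
   because [0 <= x]. *)
case: (ex_minnP ex) => -[|j] hj jmin; first by rewrite expr0 in hj; lra.
exists j; apply/andP; split; last by lra.
by rewrite lerBlDr -lerBlDl leNgt; apply/negP => /jmin; rewrite ltnn.
Qed.

Lemma expr_gap_inj {R : realType} (a x : R) (i j : nat) : 0 < a < 1 ->
  1 - a ^+ i <= x < 1 - a ^+ i.+1 -> 1 - a ^+ j <= x < 1 - a ^+ j.+1 -> i = j.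
Proof.
move=> /andP[a0 a1].
wlog ij : i j / (i <= j)%N => [h|].
  by case/orP: (leq_total i j) => ij p q; [exact: h|apply/esym/h].
rewrite leq_eqVlt in ij; case/orP: ij => [/eqP//|ij] /andP[_ p] /andP[q _].
have : a ^+ j <= a ^+ i.+1 by apply: ler_wiXn2l => //; exact: ltW.
by move=> ?; exfalso; lra.
Qed.

Lemma expr_gap_mid {R : realType} (a : R) (j : nat) : 0 < a < 1 / 2 ->
  1 - a ^+ j < 1 - a ^+ j + a ^+ j.+1 < 1 - a ^+ j.+1.
Proof.
move=> /andP[a0 a1]; have : 0 < a ^+ j by rewrite exprn_gt0.
by move=> h; rewrite exprS; apply/andP; split; nra.
Qed.

Lemma falpha_specE {R : realType} (a x y : R) : falpha_spec a x y <->
  [\/ exists j, 1 - a ^+ j <= x <= 1 - a ^+ j + a ^+ j.+1 /\ y = falpha_left a j x,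
      exists j, 1 - a ^+ j + a ^+ j.+1 < x < 1 - a ^+ j.+1 /\ y = falpha_right a j x
    | x = 1 /\ y = 0].
Proof.
split=> -[].
- by move=> [[|j] []]// _ xj ->; constructor 1; exists j; rewrite in_itv in xj.
- by move=> [[|j] []]// _ xj ->; constructor 2; exists j; rewrite in_itv in xj.
- by move=> h; constructor 3.
- by move=> [j [xj ->]]; constructor 1; exists j.+1; rewrite in_itv.
- by move=> [j [xj ->]]; constructor 2; exists j.+1; rewrite in_itv.
- by move=> h; constructor 3.
Qed.

Lemma falpha_spec_cases {R : realType} (a x y : R) : 0 < a < 1 / 2 ->
  falpha_spec a x y ->
  (x = 1 /\ y = 0) \/ exists j, 1 - a ^+ j <= x < 1 - a ^+ j.+1 /\
    y = if x <= 1 - a ^+ j + a ^+ j.+1 then falpha_left a j x else falpha_right a j x.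
Proof.
move=> a012 /falpha_specE[[j [/andP[x1 x2] ->]]|[j [/andP[x1 x2] ->]]|]; [right|right|by left];
  exists j; have /andP[m1 m2] := expr_gap_mid a j a012.
  by rewrite x1 x2; split=> //; exact: le_lt_trans m2.
by rewrite x2 (ltW (lt_trans m1 x1)) leNgt x1.
Qed.

Lemma falpha_spec_inj {R : realType} (a x y z : R) : 0 < a < 1 / 2 ->
  falpha_spec a x y -> falpha_spec a x z -> y = z.
Proof.
move=> a012; have a01 : 0 < a < 1 by lra.
have gt0 j : 0 < a ^+ j by case/andP: a01 => a0 _; rewrite exprn_gt0.
move=> /(falpha_spec_cases a x y a012) + /(falpha_spec_cases a x z a012).
case=> [[x1 ->]|[i [xi ->]]]; case=> [[x1' ->]|[j [xj ->]]] => //.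
- by have := gt0 j.+1; lra.
- by have := gt0 i.+1; lra.
- by rewrite (expr_gap_inj a x i j a01 xi xj).
Qed.

Lemma falphaE {R : realType} (a x y : R) : 0 < a < 1 / 2 ->
  falpha_spec a x y -> falpha a x = y.
Proof.
move=> a012 xy; apply: (@falpha_spec_inj R a x) => //.
exact: (@xgetI _ 0 [set y | falpha_spec a x y] y).
Qed.

Lemma falpha_specP {R : realType} (a x : R) : 0 < a < 1 / 2 -> 0 <= x <= 1 ->
  falpha_spec a x (falpha a x).
Proof.
move=> a012 /andP[x0 x1]; have a01 : 0 < a < 1 by lra.
suff [y xy] : exists y, falpha_spec a x y by rewrite (falphaE a x y).
move: x1; rewrite le_eqVlt => /orP[/eqP->|x1].
  by exists 0; apply/falpha_specE; constructor 3.
have [j /andP[j1 j2]] := exists_expr_gap a x a01 ltac:(lra).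
have [h|h] := leP x (1 - a ^+ j + a ^+ j.+1).
  by exists (falpha_left a j x); apply/falpha_specE; constructor 1; exists j; split => //; lra.
by exists (falpha_right a j x); apply/falpha_specE; constructor 2; exists j; split => //; lra.
Qed.

Lemma falpha_itv {R : realType} (a x : R) : 0 < a < 1 / 2 -> 0 <= falpha a x <= 1.
Proof.
move=> a012; have /andP[a0 a12] := a012; rewrite /falpha.
case: xgetP => [y _ /falpha_specE|_]; last by rewrite lexx ler01.
have le1 j : a ^+ j <= 1 by rewrite exprn_ile1//; lra.
have gt0 j : 0 < a ^+ j by rewrite exprn_gt0.
case=> [[j [/andP[x1 x2] ->]]|[j [/andP[x1 x2] ->]]|[_ ->]]; last by rewrite lexx ler01.
  rewrite /falpha_left; have := le1 j; have := gt0 j; have := expr_gap_mid a j a012; lra.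
have d0 : 0 < 1 - 2 * a by lra.
have c0 : 0 < 1 - a + a ^+ 2 by nra.
have -> : falpha_right a j x =
    ((1 - a + a ^+ 2) * (1 - x) - a ^+ j.+2 * (2 - a)) / (1 - 2 * a).
  by rewrite /falpha_right; field; apply/andP; split; apply/eqP; lra.
have := gt0 j; have := le1 j; rewrite ?(exprS a j.+1) ?(exprS a j) in x1 x2 *.
set t := a ^+ j in x1 x2 * => t1 t0.
(* The numerator is affine in [x]; at the right and left ends of the clause it equals
   [a * t * (1 - a) * (1 - 2 * a)] and [t * (1 - 2 * a)]. *)
have n0 : 0 <= (1 - a + a ^+ 2) * (1 - x) - a * (a * t) * (2 - a).
  have h1 := ler_wpM2l (ltW c0) (ltW x2).
  have h2 : 0 <= a * t * ((1 - a) * (1 - 2 * a)) by rewrite !mulr_ge0 ?ltW//; lra.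
  by move: h1 h2; rewrite expr2; lra.
have n1 : (1 - a + a ^+ 2) * (1 - x) - a * (a * t) * (2 - a) <= 1 - 2 * a.
  have h1 := ler_wpM2l (ltW c0) (ltW x1).
  have h2 : 0 <= (1 - t) * (1 - 2 * a) by rewrite !mulr_ge0//; lra.
  by move: h1 h2; rewrite expr2; lra.
by apply/andP; split; [exact: divr_ge0 n0 (ltW d0)|rewrite ler_pdivrMr// mul1r].
Qed.

(** The odometer without carry: a leading digit 0 becomes 1. *)
Lemma falpha_low {R : realType} (a x : R) : 0 < a < 1 / 2 -> 0 <= x <= a ->
  falpha a x = x + 1 - a.
Proof.
move=> a012 xa; apply: falphaE => //; apply/falpha_specE; constructor 1.
by exists 0%N; rewrite /falpha_left expr0 expr1; split; lra.
Qed.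

(** The odometer with carry: a leading digit 1 becomes 0 and the map acts on the tail. The affine
    change of variable turns the clause of index [j] at [x] into that of index [j.+1]. *)
Lemma falpha_high {R : realType} (a x : R) : 0 < a < 1 / 2 -> 0 <= x <= 1 ->
  falpha a (1 - a + a * x) = a * falpha a x.
Proof.
move=> a012 x01; apply: falphaE => //; apply/falpha_specE.
have /andP[a0 _] := a012.
have e1 t : (1 - a * t <= 1 - a + a * x) = (1 - t <= x).
  by rewrite -(ler_pM2l a0 (1 - t)); apply/idP/idP; lra.
have e2 t : (1 - a + a * x < 1 - a * t) = (x < 1 - t).
  by rewrite -(ltr_pM2l a0 x); apply/idP/idP; lra.
have e3 t u : (1 - a + a * x <= 1 - a * t + a * u) = (x <= 1 - t + u).
  by rewrite -(ler_pM2l a0 x); apply/idP/idP; lra.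
have e4 t u : (1 - a * t + a * u < 1 - a + a * x) = (1 - t + u < x).
  by rewrite -(ltr_pM2l a0 _ x); apply/idP/idP; lra.
have /falpha_specE := falpha_specP a x a012 x01.
case=> [[j [xj ->]]|[j [xj ->]]|[-> ->]].
- constructor 1; exists j.+1; rewrite (exprS a j.+1) (exprS a j) e1 e3 -(exprS a j).
  by split => //; rewrite /falpha_left !exprS; ring.
- constructor 2; exists j.+1; rewrite (exprS a j.+1) (exprS a j) e4 e2 -(exprS a j).
  by split => //; rewrite /falpha_right !exprS; field; apply/eqP; lra.
- by constructor 3; split; ring.
Qed.

(** The intervals [Ialpha], indexed by numbers instead of words so that the odometer becomes the
    successor. *)
Definition cylinder {R : realType} (a : R) (k n : nat) : set R :=
  `[kap a k n, kap a k n + a ^+ k]%classic.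

Lemma cylinder_itv01 {R : realType} (a x : R) k n : 0 < a < 1 -> cylinder a k n x -> 0 <= x <= 1.
Proof.
move=> a01; rewrite /cylinder /= in_itv/= => /andP[x0 x1].
by have := kap_itv a k n a01; lra.
Qed.

(** Induction on [k]: for odd [n] the carry passes to [n./2] by [falpha_high], for even [n] only the
    leading digit changes, by [falpha_low]. *)
Lemma falpha_cylinder {R : realType} (a x : R) k n : 0 < a < 1 / 2 -> cylinder a k n x ->
  cylinder a k n.+1 (falpha a x).
Proof.
move=> a012; have a01 : 0 < a < 1 by lra.
have /andP[a0 _] := a01.
elim: k n x => [|k IH] n x.
  by rewrite /cylinder /= !in_itv/= expr0 add0r falpha_itv.
have := @cylinder_itv01 R a x k.+1 n a01.
rewrite /cylinder /= !in_itv/= => x01 xJ; have {}x01 := x01 xJ.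
have [on|en] := boolP (odd n).
  pose y := (x - (1 - a)) / a.
  have xE : x = 1 - a + a * y by rewrite /y; field; rewrite gt_eqF.
  have yJ : cylinder a k n./2 y.
    move: xJ; rewrite on xE exprS /cylinder /= in_itv/= => xJ.
    by apply/andP; split; rewrite -(ler_pM2l a0); lra.
  rewrite xE falpha_high//; last exact: cylinder_itv01 yJ.
  rewrite /= mulr0 add0r exprS -mulrDr !ler_pM2l//.
  have := IH _ _ yJ; rewrite /cylinder /= in_itv/=.
  by have -> : uphalf n = n./2.+1 by rewrite uphalf_half on.
have -> : uphalf n = n./2 by rewrite uphalf_half (negbTE en).
rewrite (negbTE en) /= mulr0 add0r mulr1 in xJ *.
have := kap_itv a k n./2 a01; rewrite exprS in xJ * => /andP[h0 h1].
have := ler_wpM2l (ltW a0) h1; have := mulr_ge0 (ltW a0) h0 => h2 h3.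
by rewrite falpha_low//; lra.
Qed.

Lemma iter_falpha_cylinder {R : realType} (a x : R) k n i : 0 < a < 1 / 2 -> cylinder a k n x ->
  cylinder a k (n + i) (iter i (falpha a) x).
Proof.
by move=> a012 xJ; elim: i => [|i IH]; rewrite ?addn0// addnS; exact: falpha_cylinder.
Qed.

(** The map is affine on each of countably many intervals and takes the default value 0 where no
    clause applies. *)
Lemma measurable_falpha {R : realType} (a : R) : 0 < a < 1 / 2 ->
  measurable_fun [set: R] (falpha a).
Proof.
move=> a012.
pose E1 j := `[1 - a ^+ j, 1 - a ^+ j + a ^+ j.+1]%classic : set R.
pose E2 j := `]1 - a ^+ j + a ^+ j.+1, 1 - a ^+ j.+1[%classic : set R.
pose D := (\bigcup_j E1 j `|` \bigcup_j E2 j) `|` [set 1 : R].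
have mD : measurable D.
  apply: measurableU => //.
  by apply: measurableU; apply: bigcup_measurable => j _; exact: measurable_itv.
have -> : [set: R] = D `|` ~` D by rewrite setUv.
apply/measurable_funU => //; first exact: measurableC.
split; last first.
  apply: (@eq_measurable_fun _ _ _ _ _ (cst (0 : R))); last exact: measurable_cst.
  move=> x; rewrite inE => xD; rewrite /falpha xgetPN// => y /falpha_specE h.
  apply: xD; case: h => [[j [xj _]]|[j [xj _]]|[-> _]]; [left; left|left; right|by right].
    by exists j => //; rewrite /E1 /= in_itv.
  by exists j => //; rewrite /E2 /= in_itv.
apply/measurable_funU => //.
  by apply: measurableU; apply: bigcup_measurable => j _; exact: measurable_itv.
split; last exact: measurable_fun_set1.
apply/measurable_funU.
- by apply: bigcup_measurable => j _; exact: measurable_itv.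
- by apply: bigcup_measurable => j _; exact: measurable_itv.
split; apply/measurable_fun_bigcup => j; try exact: measurable_itv.
  apply: (@eq_measurable_fun _ _ _ _ _ (falpha_left a j)).
    move=> x; rewrite inE /E1 /= in_itv/= => xj; apply/esym/falphaE => //.
    by apply/falpha_specE; constructor 1; exists j.
  by do 3! (apply: measurable_funD => //).
apply: (@eq_measurable_fun _ _ _ _ _ (falpha_right a j)).
  move=> x; rewrite inE /E2 /= in_itv/= => xj; apply/esym/falphaE => //.
  by apply/falpha_specE; constructor 2; exists j.
apply: measurable_funD => //; apply: measurable_funM => //; exact: measurable_funD.
Qed.

(** * Existence of the measure *)

(** The shift on the binary digits of [t] in [0, 1[, whose first digit is 1 exactly when
    [1 / 2 <= t]. *)
Definition doubling {R : realType} (t : R) : R := if t < 1 / 2 then 2 * t else 2 * t - 1.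

Fixpoint coding_approx {R : realType} (a : R) (k : nat) (t : R) : R :=
  if k is k'.+1 then
    (if t < 1 / 2 then 0 else 1 - a) + a * coding_approx a k' (doubling t)
  else 0.

(* Reads the binary digits of [t] as digits in base [a]: Lebesgue measure on [0, 1]
   is the Bernoulli measure, and its image under [coding a] is mu_alpha. *)
Definition coding {R : realType} (a t : R) : R := limn (fun k => coding_approx a k t).

Lemma measurable_doubling {R : realType} : measurable_fun [set: R] doubling.
Proof.
apply: measurable_fun_if => //.
- exact: measurable_fun_ltr.
- by apply: measurable_funTS; apply: measurable_funB => //; exact: mulrl_measurable.
Qed.

Lemma measurable_coding_approx {R : realType} (a : R) k :
  measurable_fun [set: R] (coding_approx a k).
Proof.
elim: k => [|k IH] /=; first exact: measurable_cst.
apply: measurable_funD; last first.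
  apply: measurable_funM => //.
  by apply: measurableT_comp => //; exact: measurable_doubling.
by apply: measurable_fun_if => //; exact: measurable_fun_ltr.
Qed.

Lemma coding_approx_itv {R : realType} (a t : R) k : 0 < a < 1 ->
  0 <= coding_approx a k t <= 1.
Proof.
move=> /andP[a0 a1]; elim: k t => [|k IH] t /=; first by rewrite lexx ler01.
have /andP[h0 h1] := IH (doubling t).
by have := ler_wpM2l (ltW a0) h1; have := mulr_ge0 (ltW a0) h0; case: ifP => _; lra.
Qed.

Lemma coding_approx_nondecreasing {R : realType} (a t : R) : 0 < a < 1 ->
  nondecreasing_seq (fun k => coding_approx a k t).
Proof.
move=> a01; apply/nondecreasing_seqP => k; have /andP[a0 _] := a01.
elim: k t => [|k IH] t; first by have /andP[] := @coding_approx_itv R a t 1 a01.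
by rewrite [leLHS]/= [leRHS]/= lerD2l ler_pM2l//; exact: IH.
Qed.

Lemma cvg_coding {R : realType} (a t : R) : 0 < a < 1 ->
  coding_approx a k t @[k --> \oo] --> coding a t.
Proof.
move=> a01; apply: nondecreasing_is_cvgn; first exact: coding_approx_nondecreasing.
by exists 1 => _ [k _ <-]; have /andP[] := coding_approx_itv a t k a01.
Qed.

Lemma coding_itv {R : realType} (a t : R) : 0 < a < 1 -> 0 <= coding a t <= 1.
Proof.
move=> a01; have c := cvg_coding a t a01.
apply/andP; split.
  by apply: limr_ge; [exact: cvgP c|apply: nearW => k; have /andP[] := coding_approx_itv a t k a01].
by apply: limr_le; [exact: cvgP c|apply: nearW => k; have /andP[] := coding_approx_itv a t k a01].
Qed.

Lemma codingE {R : realType} (a t : R) : 0 < a < 1 ->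
  coding a t = (if t < 1 / 2 then 0 else 1 - a) + a * coding a (doubling t).
Proof.
move=> a01; apply/cvg_lim => //; rewrite -cvg_shiftS /=.
by apply: cvgD; [exact: cvg_cst|apply: cvgM; [exact: cvg_cst|exact: cvg_coding]].
Qed.

Lemma measurable_coding {R : realType} (a : R) : 0 < a < 1 ->
  measurable_fun [set: R] (coding a).
Proof.
move=> a01; apply: (measurable_fun_cvg (measurable_coding_approx a)) => t _.
exact: cvg_coding.
Qed.

(* For [u] of length [k], the [t] in [0, 1[ whose first [k] binary digits are
   those of [u] form [dyadic u, dyadic u + 2^-k[. *)
Fixpoint dyadic {R : realType} (u : seq bool) : R :=
  if u is b :: u' then (b%:R + dyadic u') / 2 else 0.

(** Horner form of [kappa], suited to induction on the word. *)
Fixpoint kapseq {R : realType} (a : R) (u : seq bool) : R :=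
  if u is b :: u' then (1 - a) * b%:R + a * kapseq a u' else 0.

Lemma kappa_kapseq {R : realType} (a : R) k (u : k.-tuple bool) :
  kappa a u = kapseq a u.
Proof.
rewrite /kappa; under eq_bigr => i _ do rewrite (tnth_nth false) /=.
move: (size_tuple u); move: (tval u) => {}u <- {k};
elim: u => [|b u IH] /=; first by rewrite big_ord0 mulr0.
rewrite big_ord_recl /= expr0 mulr1 mulrDr -IH mulrCA; congr (_ + _ * _).
by rewrite mulr_sumr; apply: eq_bigr => i _; rewrite exprS mulrCA.
Qed.

Lemma kapseq_itv {R : realType} (a : R) u :
  0 < a < 1 -> 0 <= kapseq a u <= 1 - a ^+ size u.
Proof.
move=> /andP[a0 a1]; elim: u => [|b u /andP[h0 h1]] /=; first by rewrite expr0 subrr lexx.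
have := ler_wpM2l (ltW a0) h1; have := mulr_ge0 (ltW a0) h0; rewrite exprS.
by case: b => /= *; lra.
Qed.

Lemma dyadic_itv {R : realType} u : 0 <= @dyadic R u <= 1 - 2 ^- size u.
Proof.
elim: u => [|b u /andP[h0 h1]] /=; first by rewrite expr0 invr1 subrr lexx.
by rewrite exprS invfM; case: b => /=; lra.
Qed.

(** If the first digits of [t] and [u] agree, both sides reduce to [doubling t] and the tail. If
    they differ, both sides fail: digit 0 codes into [0, a] and digit 1 into [1 - a, 1], which are
    disjoint as [a < 1 / 2]. *)
Lemma coding_cylinder {R : realType} (a t : R) (u : seq bool) :
  0 < a < 1 / 2 -> 0 <= t < 1 ->
  (kapseq a u <= coding a t <= kapseq a u + a ^+ size u) =
  (dyadic u <= t < dyadic u + 2 ^- size u).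
Proof.
move=> a012; have a01 : 0 < a < 1 by lra.
have /andP[a0 a1] := a012.
elim: u t => [|b u IH] t t01 /=.
  by rewrite !expr0 invr1 !add0r t01 coding_itv.
have d01 : 0 <= doubling t < 1 by rewrite /doubling; case: ifP; lra.
have {IH} := IH _ d01; rewrite (codingE a t)// !exprS invfM.
have /andP[c0 c1] := coding_itv a (doubling t) a01.
have /andP[k0 k1] := kapseq_itv a u a01.
have /andP[e0 e1] := @dyadic_itv R u.
have ac := mulr_ge0 (ltW a0) c0; have ac1 := ler_wpM2l (ltW a0) c1.
have ak := mulr_ge0 (ltW a0) k0; have ak1 := ler_wpM2l (ltW a0) k1.
have p0 : 0 < 2 ^- size u :> R by rewrite invr_gt0 exprn_gt0.
have A0 : 0 < a ^+ size u by rewrite exprn_gt0.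
have scale s : (s + a * kapseq a u <= s + a * coding a (doubling t)
      <= s + a * kapseq a u + a * a ^+ size u) =
    (kapseq a u <= coding a (doubling t) <= kapseq a u + a ^+ size u).
  by rewrite -addrA -mulrDr !lerD2l !ler_pM2l.
have [th|th] := ltP t (1 / 2); case: b => /=.
- by rewrite mulr1 => _; transitivity false; [|apply/esym];
    apply/negbTE/negP => /andP[h1 h2]; lra.
- by rewrite mulr0 scale => ->; rewrite /doubling th; apply/idP/idP; lra.
- rewrite mulr1 scale => ->; rewrite /doubling ltNge th /=; apply/idP/idP; lra.
- by rewrite mulr0 => _; transitivity false; [|apply/esym];
    apply/negbTE/negP => /andP[h1 h2]; lra.
Qed.

(** The measure picked by [get] has the property once some measure has it; the image of the uniform
    measure under [coding a] is such a measure. *)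
Lemma is_mu_alpha_mu_alpha {R : realType} (a : R) : 0 < a < 1 / 2 ->
  is_mu_alpha a (mu_alpha a).
Proof.
move=> a012; have a01 : 0 < a < 1 by lra.
apply: (@getPex _ (is_mu_alpha a : set (pprobability (measurableTypeR R) R))).
pose P : probability (measurableTypeR R) R := uniform_prob (@ltr01 R).
have mX : @measurable_fun _ _ (measurableTypeR R) (measurableTypeR R) setT (coding a).
  exact: measurable_coding.
pose X : {mfun measurableTypeR R >-> measurableTypeR R} :=
  HB.pack (coding a) (isMeasurableFun.Build _ _ _ _ _ mX).
have PE (U : set (measurableTypeR R)) : measurable U -> P U = lebesgue_measure (U `&` `[0, 1]).
  move=> mU; rewrite -[P U]/(uniform_prob (@ltr01 R) U) /uniform_prob integral_uniform_pdf.
  rewrite (eq_integral (cst 1%E)); last first.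
    move=> x; rewrite inE => -[_] /=; rewrite in_itv/= => x01.
    by rewrite /uniform_pdf x01 subr0 invr1.
  by rewrite integral_cst ?mul1e//; exact: measurableI.
have mpre (i : interval R) : measurable (coding a @^-1` [set` i] : set (measurableTypeR R)).
  by rewrite -[_ @^-1` _]setTI; apply: (mX) => //; exact: measurable_itv.
exists (distribution P X : probability _ _); split=> [|k u k1].
  rewrite /distribution /pushforward /= PE; last exact: mpre.
  rewrite (_ : _ `&` _ = `[0, 1]%classic).
    by rewrite lebesgue_measure_itv /= lte01 oppr0 adde0.
  by apply/setIidr => t _ /=; rewrite in_itv/= coding_itv.
rewrite /distribution /pushforward /= PE; last exact: mpre.
pose U : set R := coding a @^-1` Ialpha a u.
pose d : R := dyadic u.
have cc t : 0 <= t < 1 -> (coding a t \in `[kappa a u, kappa a u + a ^+ k]) =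
    (d <= t < d + 2 ^- k).
  by move=> /(coding_cylinder a t u a012); rewrite size_tuple in_itv/= kappa_kapseq.
(* The point 1 is outside the range of [coding_cylinder]; it is split off and contributes measure
   0. *)
have UE : U `&` `[0, 1] = `[d, d + 2 ^- k[ `|` (U `&` [set 1]).
  have := @dyadic_itv R u; rewrite size_tuple -/d => /andP[d0 d1].
  apply/seteqP; split => t /=.
    rewrite in_itv/= => -[Ut /andP[t0]]; rewrite le_eqVlt => /orP[/eqP t1|t1]; [right|left].
      by split.
    by move: Ut; rewrite /U /Ialpha /= cc ?t0// in_itv.
  case=> [|[Ut t1]]; last by split=> //; rewrite t1 in_itv/= ler01 lexx.
  rewrite in_itv/= => /andP[t0 t1].
  have t01 : 0 <= t < 1 by lra.
  rewrite in_itv/=; split; last lra.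
  by rewrite /U /Ialpha /= cc// t0.
rewrite UE measureU0//=.
- rewrite lebesgue_measure_itv /= lte_fin ltrDl invr_gt0 exprn_gt0//.
  by rewrite -EFinD addrAC subrr add0r.
- by apply: measurableI => //; exact: mpre.
- apply/eqP; rewrite eq_le measure_ge0 andbT -(lebesgue_measure_set1 (1 : R)).
  by apply: le_measure; rewrite ?inE//; apply: measurableI => //; exact: mpre.
Qed.

(** * Correlation integrals as counts of basic boxes *)

Lemma cylinder_disjoint {R : realType} (a x : R) k (n m : 'I_(2 ^ k)) : 0 < a < 1 / 2 ->
  cylinder a k n x -> cylinder a k m x -> n = m.
Proof.
move=> a012; rewrite /cylinder /= !in_itv/= => /andP[n0 n1] /andP[m0 m1].
apply: val_inj; rewrite /= -(modn_small (ltn_ord n)) -(modn_small (ltn_ord m)).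
by apply: (kap_gap a) => //; rewrite ler_norml; lra.
Qed.

Lemma mu_alpha_cylinder {R : realType} (a : R) k n : 0 < a < 1 / 2 ->
  mu_alpha a (cylinder a k n) = (2 ^- k)%:E.
Proof.
(* The defining property covers words of positive length; for length 0 the cylinder is [0, 1]. *)
move=> /is_mu_alpha_mu_alpha[m01 mI]; case: k => [|k].
  by rewrite /cylinder /= expr0 add0r invr1.
by rewrite -(mI _ [tuple odd (n %/ 2 ^ i) | i < k.+1])// /Ialpha -kappaE.
Qed.

Lemma measurable_cylinder {R : realType} (a : R) k n :
  measurable (cylinder a k n : set (measurableTypeR R)).
Proof. exact: measurable_itv. Qed.

Lemma measure_bigsetU_const {R : realType} d (T : measurableType d) (I : choiceType)
    (mu : {measure set T -> \bar R}) (F : I -> set T) (c : R) (s : seq I) :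
  (forall i, measurable (F i)) -> (forall i, mu (F i) = c%:E) ->
  (forall i j, F i `&` F j !=set0 -> i = j) -> uniq s ->
  mu (\big[setU/set0]_(i <- s) F i) = ((size s)%:R * c)%:E.
Proof.
move=> mF muF dF; elim: s => [|i s IH] /=; first by rewrite big_nil measure0 mul0r.
move=> /andP[si us]; rewrite big_cons measureU//.
- by rewrite [X in (X + _)%E]muF [X in (_ + X)%E]IH// -EFinD -natr1 mulrDl mul1r addrC.
- exact: bigsetU_measurable.
- apply/seteqP; split => // x [Fix]; rewrite -bigcup_seq => -[j /= js Fjx].
  by case/negP: si; rewrite (dF i j)//; exists x.
Qed.

(** Boxes of level [k] are pairwise disjoint and have product measure [4 ^- k] each. *)
Lemma card_boxes_le {R : realType} (a : R) k (S : {set 'I_(2 ^ k) * 'I_(2 ^ k)})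
    (A : set (measurableTypeR R * measurableTypeR R)) :
  0 < a < 1 / 2 -> measurable A ->
  (forall p, p \in S -> cylinder a k p.1 `*` cylinder a k p.2 `<=` A) ->
  ((#|S|%:R / 4 ^+ k)%:E <= (mu_alpha a \x mu_alpha a)%E A)%E.
Proof.
move=> a012 mA SA.
pose F (p : 'I_(2 ^ k) * 'I_(2 ^ k)) : set (measurableTypeR R * measurableTypeR R) :=
  cylinder a k p.1 `*` cylinder a k p.2.
have mF p : measurable (F p) by apply: measurableX; exact: measurable_cylinder.
rewrite cardE -(@measure_bigsetU_const _ _ _ _ (mu_alpha a \x mu_alpha a)%E F _ (enum S))//.
- apply: le_measure; rewrite ?inE//; first exact: bigsetU_measurable.
  by rewrite -bigcup_seq => z [p /=]; rewrite mem_enum => /SA; apply.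
- move=> p; rewrite [LHS]product_measure1E; try exact: measurable_cylinder.
  rewrite [X in (X * _)%E]mu_alpha_cylinder// [X in (_ * X)%E]mu_alpha_cylinder//.
  by rewrite -EFinM -invfM -exprMn -natrM.
- move=> [n m] [n' m'] [[x y] [[/= xn ym] [/= xn' ym']]].
  by rewrite (cylinder_disjoint a x k n n')// (cylinder_disjoint a y k m m').
- exact: enum_uniq.
Qed.

Lemma iter_falpha_itv {R : realType} (a x : R) i : 0 < a < 1 / 2 -> 0 <= x <= 1 ->
  0 <= iter i (falpha a) x <= 1.
Proof. by case: i => //= i a012 _; exact: falpha_itv. Qed.

(** Here [sup] is a genuine least upper bound: time 0 is admissible, so the set is nonempty, and
    orbits stay in [0, 1], so it is bounded by 1. *)
Lemma rho_le {R : realType} (a x y s : R) l : 0 < a < 1 / 2 -> l <> Some 0%N ->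
  0 <= x <= 1 -> 0 <= y <= 1 ->
  rho a l x y <= s <->
  forall i, below l i -> `|iter i (falpha a) x - iter i (falpha a) y| <= s.
Proof.
move=> a012 l0 x01 y01; split=> [rs i li|h].
  apply: le_trans rs; apply: ub_le_sup; last by exists i.
  exists 1 => _ [j _ <-]; rewrite ler_norml.
  have := iter_falpha_itv a x j a012 x01; have := iter_falpha_itv a y j a012 y01; lra.
apply: ge_sup; last by move=> _ [i li <-]; exact: h.
by exists `|x - y|; exists 0%N => //; case: l l0 {h} => [[|n]|].
Qed.

Definition close_set {R : realType} (a : R) (l : option nat) (s : R) :
    set (measurableTypeR R * measurableTypeR R) :=
  [set z | [/\ z.1 \in `[0, 1], z.2 \in `[0, 1] & rho a l z.1 z.2 <= s]].

Lemma measurable_iter_falpha {R : realType} (a : R) i : 0 < a < 1 / 2 ->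
  @measurable_fun _ _ (measurableTypeR R) (measurableTypeR R) setT (iter i (falpha a)).
Proof.
move=> a012; elim: i => [|i IH]; first exact: measurable_id.
by apply: measurableT_comp => //; exact: measurable_falpha.
Qed.

(** By [rho_le] the set is a countable intersection of measurable conditions, one for each
    admissible time. *)
Lemma measurable_close_set {R : realType} (a s : R) l : 0 < a < 1 / 2 ->
  l <> Some 0%N -> measurable (close_set a l s).
Proof.
move=> a012 l0.
have -> : close_set a l s = (`[0, 1] `*` `[0, 1]) `&`
    \bigcap_(i in below l) [set z : measurableTypeR R * measurableTypeR R |
      `|iter i (falpha a) z.1 - iter i (falpha a) z.2| <= s].
  apply/seteqP; split => -[x y] /=.
    by move=> [x01 y01]; rewrite !in_itv/= in x01 y01 *; move/rho_le => h; split => // i /h; exact.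
  by move=> [[x01 y01] h]; split => //; apply/rho_le.
apply: measurableI; first by apply: measurableX; exact: measurable_itv.
apply: bigcap_measurable => [|i _]; first by exists 0%N; case: l l0 => [[|n]|].
have m1 : measurable_fun setT (fun z : measurableTypeR R * measurableTypeR R =>
    `|iter i (falpha a) z.1 - iter i (falpha a) z.2|).
  apply: measurableT_comp => //; apply: measurable_funB.
    by apply: measurableT_comp; [exact: measurable_iter_falpha|exact: measurable_fst].
  by apply: measurableT_comp; [exact: measurable_iter_falpha|exact: measurable_snd].
have := m1 measurableT `]-oo, s]%classic (measurable_itv _).
rewrite setTI; congr measurable; apply/seteqP; split => z /=; by rewrite in_itv.
Qed.

(** Discrete counterpart of [close_set] at level [k]. The condition may involve infinitely many
    times, hence the classical boolean. *)
Definition close_boxes {R : realType} (a : R) (l : option nat) (k : nat) (s : R) :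
    {set 'I_(2 ^ k) * 'I_(2 ^ k)} :=
  [set p : 'I_(2 ^ k) * 'I_(2 ^ k) | `[< forall i, below l i ->
     (`|kap a k (p.1 + i) - kap a k (p.2 + i)| <= s)%R >]]%SET.

Lemma close_boxesP {R : realType} (a s : R) l k (p : 'I_(2 ^ k) * 'I_(2 ^ k)) :
  reflect (forall i, below l i -> `|kap a k (p.1 + i) - kap a k (p.2 + i)| <= s)
    (p \in close_boxes a l k s).
Proof. by rewrite inE; exact: asboolP. Qed.

(** Each of the two endpoints in a difference may move by half of the slack [t - s]. *)
Lemma close_boxes_sub {R : realType} (a b s t : R) l k :
  (forall n, `|kap b k n - kap a k n| <= (t - s) / 2) ->
  close_boxes b l k s \subset close_boxes a l k t.
Proof.
move=> ab; apply/fintype.subsetP => p /close_boxesP ps; apply/close_boxesP => i li.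
move: (ps i li) (ab (p.1 + i)%N) (ab (p.2 + i)%N); rewrite !ler_norml.
by move=> /andP[? ?] /andP[? ?] /andP[? ?]; lra.
Qed.

Lemma close_boxes_mono {R : realType} (a s t : R) l k : s <= t ->
  close_boxes a l k s \subset close_boxes a l k t.
Proof. by move=> st; apply: close_boxes_sub => n; rewrite subrr normr0; lra. Qed.

(** At each time both orbits exceed their left endpoints by amounts in [0, a^k], so the two
    differences deviate by at most [a ^+ k]. *)
Lemma rho_cylinder {R : realType} (a x y s : R) l k n m : 0 < a < 1 / 2 -> l <> Some 0%N ->
  cylinder a k n x -> cylinder a k m y ->
  ((forall i, below l i -> `|kap a k (n + i) - kap a k (m + i)| <= s - a ^+ k) ->
    rho a l x y <= s) /\
  (rho a l x y <= s ->
    forall i, below l i -> `|kap a k (n + i) - kap a k (m + i)| <= s + a ^+ k).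
Proof.
move=> a012 l0 xJ yJ; have a01 : 0 < a < 1 by lra.
have rhoE := rho_le a x y s l a012 l0
  (cylinder_itv01 a x k n a01 xJ) (cylinder_itv01 a y k m a01 yJ).
have close i : `|(iter i (falpha a) x - iter i (falpha a) y) -
    (kap a k (n + i) - kap a k (m + i))| <= a ^+ k.
  have := iter_falpha_cylinder a x k n i a012 xJ; have := iter_falpha_cylinder a y k m i a012 yJ.
  rewrite /cylinder /= !in_itv/= ler_norml => /andP[? ?] /andP[? ?]; lra.
split=> [h|/rhoE h i li].
  apply/rhoE => i li; move: (h i li) (close i); rewrite !ler_norml.
  by move=> /andP[? ?] /andP[? ?]; lra.
move: (h i li) (close i); rewrite !ler_norml.
by move=> /andP[? ?] /andP[? ?]; lra.
Qed.

Lemma corr_intE {R : realType} (a r : R) l : 0 < a < 1 / 2 -> l <> Some 0%N ->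
  (mu_alpha a \x mu_alpha a)%E (close_set a l r) = (corr_int l r a)%:E /\
  (mu_alpha a \x mu_alpha a)%E (~` close_set a l r) = (1 - corr_int l r a)%:E.
Proof.
move=> a012 l0; have mA := measurable_close_set a r l a012 l0.
set mm := (mu_alpha a \x mu_alpha a)%E.
have mmT : mm setT = 1%E.
  rewrite -setXTT [LHS]product_measure1E//.
  by rewrite [X in (X * _)%E]probability_setT [X in (_ * X)%E]probability_setT mule1.
have fin : mm (close_set a l r) \is a fin_num.
  rewrite ge0_fin_numE; last exact: measure_ge0.
  apply: (@le_lt_trans _ _ (mm setT)); last by rewrite mmT ltry.
  by apply: le_measure; rewrite ?inE.
have cE : mm (close_set a l r) = (corr_int l r a)%:E by rewrite /corr_int fineK.
split => //; rewrite /mm in cE mmT fin *; rewrite EFinB -cE -mmT -(setUv (close_set a l r)).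
have -> := @measureU _ _ _ (mu_alpha a \x mu_alpha a)%E _ _ mA (measurableC mA) (setICr _).
by rewrite [X in (X - _)%E]addeC addeK.
Qed.

Lemma corr_int_ge {R : realType} (a r : R) l k : 0 < a < 1 / 2 -> l <> Some 0%N ->
  #|close_boxes a l k (r - a ^+ k)|%:R / 4 ^+ k <= corr_int l r a.
Proof.
move=> a012 l0; rewrite -lee_fin -(corr_intE a r l a012 l0).1.
apply: card_boxes_le => //; first exact: measurable_close_set.
move=> p /close_boxesP pS [x y] [/= xJ yJ]; have a01 : 0 < a < 1 by lra.
split; rewrite ?in_itv/=; [exact: cylinder_itv01 a01 xJ|exact: cylinder_itv01 a01 yJ|].
exact: (rho_cylinder a x y r l k p.1 p.2 a012 l0 xJ yJ).1.
Qed.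

(** An upper bound through the complement: the [4 ^ k - #|S|] boxes outside [S] avoid the close
    set. *)
Lemma corr_int_le {R : realType} (a r : R) l k : 0 < a < 1 / 2 -> l <> Some 0%N ->
  corr_int l r a <= #|close_boxes a l k (r + a ^+ k)|%:R / 4 ^+ k.
Proof.
move=> a012 l0; set S := close_boxes _ _ _ _.
have : ((#|~: S|%:R / 4 ^+ k)%:E <= (1 - corr_int l r a)%:E)%E.
  rewrite -(corr_intE a r l a012 l0).2; apply: card_boxes_le => //.
    by apply: measurableC; exact: measurable_close_set.
  move=> p; rewrite finset.inE => /close_boxesP pS [x y] [/= xJ yJ] [_ _ h].
  exact/pS/(rho_cylinder a x y r l k p.1 p.2 a012 l0 xJ yJ).2.
rewrite lee_fin.
have -> : #|~: S|%:R = 4 ^+ k - #|S|%:R :> R.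
  apply/eqP; rewrite eq_sym subr_eq -natrD addnC cardsC card_prod card_ord.
  by rewrite -expnMn natrX.
by rewrite mulrBl divff ?expf_neq0// lerD2l lerN2.
Qed.

(** Here [2 ^ k - i] represents the opposite of [i] modulo [2 ^ k]. *)
Lemma eq_modn_subl k c (i j : 'I_(2 ^ k)) :
  (c + (2 ^ k - i) = c + (2 ^ k - j) %[mod 2 ^ k])%N -> i = j.
Proof.
move=> h; apply/val_inj; rewrite /= -(modn_small (ltn_ord i)) -(modn_small (ltn_ord j)).
apply/esym/eqP; rewrite -(eqn_modDl (c + 2 ^ k)) -addnA.
have := ltn_ord i; have := ltn_ord j => hj hi.
have -> : (c + (2 ^ k + j) = c + (2 ^ k - i) + (i + j))%N by lia.
have -> : (c + 2 ^ k + i = c + (2 ^ k - j) + (i + j))%N by lia.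
by rewrite eqn_modDr; apply/eqP.
Qed.

Lemma eq_modn_addr k c (i j : 'I_(2 ^ k)) :
  (i + c = j + c %[mod 2 ^ k])%N -> i = j.
Proof.
move=> /eqP; rewrite eqn_modDr => /eqP h; apply/val_inj => /=.
by move: h; rewrite !modn_small.
Qed.

Lemma card_boundary {R : realType} (a r : R) l k : 0 < a < 1 / 2 ->
  (#|close_boxes a l k (r + 2 * a ^+ k) :\: close_boxes a l k (r - 2 * a ^+ k)| <=
   2 ^ k * ((if l is Some n then n * 2 else 2) * 5))%N.
Proof.
move=> a012; have a01 : 0 < a < 1 by lra.
case: l => [n|].
  (* A boundary pair has a time [j.1] at which the difference is near [r] or [- r]; [j.2] records
     the sign. *)
  pose c (j : 'I_n * bool) (m : 'I_(2 ^ k)) : R :=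
    kap a k (m + j.1) + (if j.2 then r else - r).
  pose A (j : 'I_n * bool) (m : 'I_(2 ^ k)) : {set 'I_(2 ^ k)} :=
    [set i : 'I_(2 ^ k) | (`|kap a k (i + j.1) - c j m| <= 2 * a ^+ k)%R]%SET.
  have := @card_pairs_le (2 ^ k) 5 _ A; rewrite card_prod card_ord card_bool; apply.
    by move=> j m; apply: card_kap_near => // i i'; exact: eq_modn_addr.
  move=> p; rewrite finset.inE => /andP[/close_boxesP pN /close_boxesP pP].
  move/existsNP: pN => [i /not_implyP[/= li /negP]]; rewrite -ltNge => h.
  have {pP} := pP i li => h'.
  have [s|s] := leP 0 (kap a k (p.1 + i) - kap a k (p.2 + i)).
    exists (Ordinal li, true); rewrite inE /c /= ler_norml.
    by rewrite ger0_norm// in h h'; lra.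
  exists (Ordinal li, false); rewrite inE /c /= ler_norml.
  by rewrite ltr0_norm// in h h'; lra.
(* The two differences of the indices [i] and [m] modulo [2 ^ k]. *)
pose g (j : bool) (m i : 'I_(2 ^ k)) : nat :=
  if j then (i + (2 ^ k - m))%N else (m + (2 ^ k - i))%N.
pose A (j : bool) (m : 'I_(2 ^ k)) : {set 'I_(2 ^ k)} :=
  [set i | (`|kap a k (g j m i) - r| <= 2 * a ^+ k)%R]%SET.
have := @card_pairs_le (2 ^ k) 5 _ A; rewrite card_bool; apply.
  move=> -[] m; apply: card_kap_near => // i i'; rewrite /g.
    exact: eq_modn_addr.
  exact: eq_modn_subl.
(* Subadditivity bounds the difference at every time by [kap] of n - m, and the bound is attained at
   time [2 ^ k - m], when the second orbit is at endpoint 0. A boundary pair thus has [kap] of n - m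
   or of m - n near [r]. *)
have kap_diff (n m : 'I_(2 ^ k)) i :
    kap a k (n + i) <= kap a k (m + i) + kap a k (n + (2 ^ k - m)).
  rewrite -(kapDexp a k (n + i) 1) muln1.
  have -> : (n + i + 2 ^ k = m + i + (n + (2 ^ k - m)))%N by have := ltn_ord m; lia.
  exact: kapD.
have kap_hit (n m : 'I_(2 ^ k)) : kap a k (m + (2 ^ k - m)) = 0.
  by rewrite subnKC 1?ltnW// -[RHS](kap0 a k) -(kapDexp a k 0 1) muln1.
move=> [n m]; rewrite finset.inE => /andP[/close_boxesP pN /close_boxesP /= pP].
move/existsNP: pN => [i /not_implyP[/= _ /negP]]; rewrite -ltNge => h.
have h1 := pP (2 ^ k - m)%N I; have h2 := pP (2 ^ k - n)%N I.
rewrite kap_hit// subr0 in h1; rewrite kap_hit// sub0r normrN in h2.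
rewrite !ger0_norm in h1 h2; last 2 first.
- by have /andP[] := kap_itv a k (m + (2 ^ k - n)) a01.
- by have /andP[] := kap_itv a k (n + (2 ^ k - m)) a01.
have d1 := kap_diff n m i; have d2 := kap_diff m n i.
have [s|s] := leP 0 (kap a k (n + i) - kap a k (m + i)).
  by exists true; rewrite inE /g /= ler_norml; rewrite ger0_norm// in h; lra.
by exists false; rewrite inE /g /= ler_norml; rewrite ltr0_norm// in h; lra.
Qed.

(** * Continuity in the parameter *)

(** Both integrals lie between the counts for [a] at [r - 2 * a ^+ k] and [r + 2 * a ^+ k]. The
    factor 3 gives [b ^+ k <= 4 / 3 * a ^+ k] and moves endpoints by at most [a ^+ k / 3], which is
    within half of the slack [2 * a ^+ k - b ^+ k]. *)
Lemma corr_int_dist {R : realType} (a b r : R) l k : 0 < a < 1 / 2 -> 0 < b < 1 / 2 ->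
  l <> Some 0%N -> 3 * k%:R * `|b - a| <= a ^+ k ->
  `|corr_int l r b - corr_int l r a| <=
    ((if l is Some n then n * 2 else 2) * 5)%:R / 2 ^+ k.
Proof.
move=> a012 b012 l0 ab; set C := (_ * 5)%N.
have a01 : 0 < a < 1 by lra.
have b01 : 0 < b < 1 by lra.
have ak0 : 0 < a ^+ k by case/andP: a01 => a0 _; rewrite exprn_gt0.
have := expr_lipschitz a b k a01 b01; rewrite ler_norml => /andP[e1 e2].
have kl n := kap_lipschitz a b k n a01 b01.
pose S s : R := #|close_boxes a l k s|%:R / 4 ^+ k.
have S_le (T : {set 'I_(2 ^ k) * 'I_(2 ^ k)}) s :
    T \subset close_boxes a l k s -> #|T|%:R / 4 ^+ k <= S s.
  by move=> h; rewrite ler_pM2r ?invr_gt0 ?exprn_gt0// ler_nat; exact: subset_leq_card.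
have le_S (T : {set 'I_(2 ^ k) * 'I_(2 ^ k)}) s :
    close_boxes a l k s \subset T -> S s <= #|T|%:R / 4 ^+ k.
  by move=> h; rewrite ler_pM2r ?invr_gt0 ?exprn_gt0// ler_nat; exact: subset_leq_card.
have bhi : corr_int l r b <= S (r + 2 * a ^+ k).
  apply: le_trans (corr_int_le b r l k b012 l0) _.
  by apply/S_le/close_boxes_sub => n; apply: le_trans (kl n) _; lra.
have blo : S (r - 2 * a ^+ k) <= corr_int l r b.
  apply: le_trans (corr_int_ge b r l k b012 l0).
  apply/le_S/close_boxes_sub => n; rewrite distrC; apply: le_trans (kl n) _; lra.
have ahi : corr_int l r a <= S (r + 2 * a ^+ k).
  by apply: le_trans (corr_int_le a r l k a012 l0) _; apply/S_le/close_boxes_mono; lra.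
have alo : S (r - 2 * a ^+ k) <= corr_int l r a.
  by apply: le_trans (corr_int_ge a r l k a012 l0); apply/le_S/close_boxes_mono; lra.
suff : S (r + 2 * a ^+ k) - S (r - 2 * a ^+ k) <= C%:R / 2 ^+ k.
  by rewrite ler_norml; lra.
rewrite /S -mulrBl -natrB; last by apply: subset_leq_card; apply: close_boxes_mono; lra.
rewrite -cardsDS; last by apply: close_boxes_mono; lra.
have -> : 4 ^+ k = 2 ^+ k * 2 ^+ k :> R by rewrite -exprMn -natrM.
rewrite invfM mulrA ler_pM2r ?invr_gt0 ?exprn_gt0// ler_pdivrMr ?exprn_gt0//.
by rewrite -natrX -natrM ler_nat mulnC; exact: card_boundary.
Qed.

Lemma continuous_corr_int {R : realType} (r : R) l : l <> Some 0%N ->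
  {in `]0, 1 / 2[, continuous (fun a : R => corr_int l r a)}.
Proof.
move=> l0 a a012'; have a012 : 0 < a < 1 / 2 by rewrite in_itv in a012'.
have a0 : 0 < a by case/andP: a012.
apply/cvgrPdist_le => e e0.
set C : R := ((if l is Some n then n * 2 else 2) * 5)%:R.
have [k hk] : exists k, C / 2 ^+ k <= e.
  have /cvgrPdist_le/(_ e e0)[N _ /(_ N (leqnn N)) hN] :
      C * (1 / 2) ^+ n @[n --> \oo] --> C * 0.
    by apply: cvgM; [exact: cvg_cst|apply: cvg_expr; rewrite ger0_norm; lra].
  exists N; move: hN => /=; rewrite mulr0 sub0r normrN expr_div_n expr1n mul1r.
  exact/le_trans/ler_norm.
(* The level [k] is fixed by [e] before [b] is taken close to [a]; [k.+1] keeps the denominator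
   nonzero when [k] is 0. *)
have d0 : 0 < a ^+ k / (3 * k.+1%:R) by rewrite divr_gt0 ?exprn_gt0// mulr_gt0.
near=> b; rewrite distrC; apply: le_trans hk; apply: corr_int_dist => //.
  by near: b; exact: (near_in_itvoo a012').
apply: (@le_trans _ _ (3 * k.+1%:R * `|b - a|)).
  by rewrite ler_wpM2r// ler_pM2l// ler_nat.
by rewrite mulrC -ler_pdivlMr ?mulr_gt0//.
Unshelve. all: by end_near. Qed.

(** Once [a ^+ k <= r], a diagonal box lies in the close set. This makes the denominator of
    [asym_det] nonzero. *)
Lemma corr_int_gt0 {R : realType} (a r : R) l : 0 < a < 1 / 2 -> l <> Some 0%N ->
  0 < r -> 0 < corr_int l r a.
Proof.
move=> a012 l0 r0; have [a0 a1] := andP a012.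
have [k hk] : exists k, a ^+ k <= r.
  have /cvgrPdist_le/(_ r r0)[N _ /(_ N (leqnn N)) hN] : a ^+ n @[n --> \oo] --> 0.
    by apply: cvg_expr; rewrite ger0_norm; lra.
  by exists N; move: hN => /=; rewrite sub0r normrN; exact/le_trans/ler_norm.
apply: lt_le_trans (corr_int_ge a r l k a012 l0).
rewrite divr_gt0 ?exprn_gt0// ltr0n card_gt0; apply/set0Pn.
have h0 : (0 < 2 ^ k)%N by rewrite expn_gt0.
exists (Ordinal h0, Ordinal h0); apply/close_boxesP => i _.
by rewrite subrr normr0; lra.
Qed.

Theorem lemma26 (R : realType) (r : R) (hr : 0 < r <= 1)
    (l : option nat) (hl : l <> Some 0%N) :
  {within `]0, 1 / 2[, continuous (fun a : R => corr_int l r a)} /\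
  {within `]0, 1 / 2[, continuous (fun a : R => asym_det l r a)}.
Proof.
have r0 : 0 < r by case/andP: hr.
have open_continuous (f : R -> R) : {in `]0, 1 / 2[, continuous f} ->
    {within `]0, 1 / 2[, continuous f}.
  by move=> fc; rewrite continuous_open_subspace; [|exact: interval_open] => a;
    rewrite inE; exact: fc.
have cc l' : l' <> Some 0%N -> {in `]0, 1 / 2[, continuous (corr_int l' r)}.
  exact: continuous_corr_int.
split; first exact/open_continuous/cc.
apply: open_continuous => a a01; have a012 : 0 < a < 1 / 2 by rewrite in_itv in a01.
have c1V : corr_int (Some 1%N) r x @[x --> a] --> corr_int (Some 1%N) r a.
  exact: cc.
have c1_neq0 : corr_int (Some 1%N) r a != 0 by rewrite gt_eqF// corr_int_gt0.
case: l hl => [n|] n0 /=; apply: cvgM; try exact: cvgV; last exact: cc.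
apply: cvgB; apply: cvgM; try exact: cvg_cst; exact: cc.
Qed.
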